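(* Let $D$ be a reduced digraph of rank larger than $2$ and with exactly one negative eigenvalue. Then $D$ is (isomorphic to) one of $T^-$, $T^-_a$, $T^-_b$, or $K^-$.
   Context: A digraph $D=(V,E)$ is finite with arc set $E\subseteq V\times V$ and no loops; both $(u,v)$ and $(v,u)$ may belong to $E$, in which case $\{u,v\}$ is called a digon. The Hermitian adjacency matrix $H=H(D)$ has entries $h_{uv}=1$ if $(u,v)\in E$ and $(v,u)\in E$; $h_{uv}=i$ if $(u,v)\in E$ and $(v,u)\notin E$; $h_{uv}=-i$ if $(u,v)\notin E$ and $(v,u)\in E$; and $h_{uv}=0$ otherwise. The rank and eigenvalues of $D$ are those of $H(D)$; eigenvalues are counted with multiplicity. Two distinct vertices $u,v$ of $D$ are twins if $H_{ux}=H_{vx}$ for every $x\in V$. A digraph is reduced if it contains no pair of twins and no isolated vertices. In the following digraphs, the listed arcs are one-directional. $T^-$: vertices $1,2,3$, digon $\{1,2\}$, arcs $(1,3),(3,2)$. $T^-_a$: vertices $1,2,3,4$, digon $\{1,2\}$, arcs $(1,3),(3,2),(2,4),(4,1)$. $T^-_b$: vertices $1,2,3,4$, digons $\{1,2\},\{3,4\}$, arcs $(1,3),(3,2),(4,1)$. $K^-$: vertices $1,2,3,4$, digons $\{1,2\},\{3,4\}$, arcs $(1,3),(3,2),(2,4),(4,1)$. *)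

(* Defs.v *)
From HB Require Import structures.
From mathcomp Require Import all_boot all_order all_algebra.

Set Implicit Arguments.
Unset Strict Implicit.
Unset Printing Implicit Defensive.

Import Order.TTheory GRing.Theory Num.Theory.
Local Open Scope ring_scope.

Record digraph := Digraph {
  vertex : finType;
  arc : rel vertex;
  arc_irr : irreflexive arc
}.

Definition isomorphic (D1 D2 : digraph) : Prop :=
  exists2 f : vertex D1 -> vertex D2,
    bijective f & forall u v, arc (f u) (f v) = arc u v.

Definition herm_entry (C : numClosedFieldType) (D : digraph)
    (u v : vertex D) : C :=
  if arc u v then (if arc v u then 1 else 'i)
  else (if arc v u then - 'i else 0).

(* MathComp matrices are indexed by ordinals, so the vertices are listed in the
   order of [enum (vertex D)]. *)
Definition herm_adj (C : numClosedFieldType) (D : digraph) :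
    'M[C]_#|vertex D| :=
  \matrix_(i, j) herm_entry C (enum_val i) (enum_val j).

Section Eigenvalues.
Variables (C : numClosedFieldType) (n : nat) (A : 'M[C]_n).

(* The roots of the characteristic polynomial, each repeated according to its
   multiplicity. *)
Definition eigenvalues : seq C :=
  sval (closed_field_poly_normal (char_poly A)).

Lemma eigenvaluesP : char_poly A = \prod_(z <- eigenvalues) ('X - z%:P).
Proof.
rewrite /eigenvalues; case: closed_field_poly_normal => r /= ->.
by rewrite (monicP (char_poly_monic A)) scale1r.
Qed.

(* In a [numClosedFieldType] the order is partial and [x < 0] says that [x] is
   real and negative. *)
Definition num_neg_eigenvalues : nat := count (fun x => x < 0) eigenvalues.

End Eigenvalues.

Definition twins (C : numClosedFieldType) (D : digraph) (u v : vertex D) :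
    Prop :=
  u <> v /\ forall x, herm_entry C u x = herm_entry C v x.

Definition isolated (D : digraph) (u : vertex D) : Prop :=
  forall v, ~~ arc u v && ~~ arc v u.

Definition reduced (C : numClosedFieldType) (D : digraph) : Prop :=
  (forall u v : vertex D, ~ twins C u v) /\
  (forall u : vertex D, ~ isolated u).

(* Vertices are numbered from 1 in the lists, so [k] there is the ordinal
   [k.-1]; [ds] lists the digons and [es] the one-directional arcs. *)
Definition list_arc (n : nat) (ds es : seq (nat * nat)) : rel 'I_n :=
  fun u v => [|| (u.+1, v.+1) \in ds, (v.+1, u.+1) \in ds
               | (u.+1, v.+1) \in es].

Fact Tm_irr :
  irreflexive (@list_arc 3 [:: (1, 2)] [:: (1, 3); (3, 2)])%N.
Proof. by case=> [[|[|[]]]]. Qed.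

Definition Tm : digraph := Digraph Tm_irr.

Fact Tma_irr :
  irreflexive (@list_arc 4 [:: (1, 2)] [:: (1, 3); (3, 2); (2, 4); (4, 1)])%N.
Proof. by case=> [[|[|[|[]]]]]. Qed.

Definition Tma : digraph := Digraph Tma_irr.

Fact Tmb_irr :
  irreflexive
    (@list_arc 4 [:: (1, 2); (3, 4)] [:: (1, 3); (3, 2); (4, 1)])%N.
Proof. by case=> [[|[|[|[]]]]]. Qed.

Definition Tmb : digraph := Digraph Tmb_irr.

Fact Km_irr :
  irreflexive
    (@list_arc 4 [:: (1, 2); (3, 4)] [:: (1, 3); (3, 2); (2, 4); (4, 1)])%N.
Proof. by case=> [[|[|[|[]]]]]. Qed.

Definition Km : digraph := Digraph Km_irr.

(* Main.v *)
From HB Require Import structures.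
From mathcomp Require Import all_boot all_order all_algebra.
From mathcomp Require Import ring.
Require Import Defs.

(** Let H be the Hermitian adjacency matrix, regarded as the Hermitian form
    B(x, y) = x H y^*.  Since H is unitarily diagonalizable with real
    eigenvalues, a single negative eigenvalue means that B is nonnegative on the
    kernel of one linear functional.  So B is positive semidefinite on the
    orthogonal complement of any w with B(w, w) < 0, and a vector of this
    complement with B(x, x) = 0 lies in the radical of B
    ([hform_orth_neg_ge0], [hform_orth_neg_radical]).  Every edge uv provides
    such a w in the span of the basis vectors e_u and e_v, so everything
    orthogonal to e_u and e_v is subject to these two facts.  Three consequences
    are used.

    - Two distinct vertices with the same entries towards u and v are twins,
      which a reduced digraph does not have
      ([same_on_edge_eq]).

    - The Schur complement of an edge uv has diagonal entry -2 Re t at x, with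
      t = h_xu h_uv h_vx.  It is nonnegative, and if it vanishes for all x then
      every row of H is a combination of the rows u and v.  As the rank exceeds
      2, some t has negative real part, so t = -1, and the only triangle with
      this product is T^- ([exists_induced_Tm]).

    - Let p, q, r span a T^-.  Its matrix is I - v v^* with v = (1, -1, i), and
      its inverse is I - v v^* / 2.  If r_y is the triple of entries of the row
      of y at p, q, r, nonnegativity of the Schur complement at y reads
      2 |r_y|^2 <= |r_y v|^2 ([attachment_norm]).  The k nonzero entries of
      r_y are units, so |r_y v| <= k, whence k = 0, or k >= 2 and the terms of
      r_y v are all equal.  This leaves eight triples: 0, which makes y
      isolated, the three rows of T^-, which make y one of p, q, r, and four
      more.  Two of these four produce T^-_b, one T^-_a, and one K^-.

    Finally there is at most one vertex outside of p, q, r: equal triples give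
    equal vertices, and of two different triples at least one is not that of
    K^-.  Its vertex has a row proportional to that of p, q or r, which forces
    the entry between the two vertices to be -1 ([new_vertex_unique]). *)
Set Implicit Arguments.
Unset Strict Implicit.
Unset Printing Implicit Defensive.
Import Order.TTheory GRing.Theory Num.Theory.
Local Open Scope ring_scope.
Local Open Scope sesquilinear_scope.

(** * Forms with one negative eigenvalue *)

Lemma char_poly_conj (F : fieldType) n (P A : 'M[F]_n) :
  P \in unitmx -> char_poly (invmx P *m A *m P) = char_poly A.
Proof.
move=> uP; pose Q := map_mx (@polyC F) P; pose Q' := map_mx (@polyC F) (invmx P).
have Q'Q : Q' *m Q = 1%:M by rewrite -map_mxM mulVmx // map_mx1.
have -> : char_poly (invmx P *m A *m P) = \det (Q' *m char_poly_mx A *m Q).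
  rewrite /char_poly /char_poly_mx !map_mxM mulmxBr mulmxBl.
  by rewrite mul_mx_scalar -scalemxAl Q'Q scalemx1.
by rewrite !det_mulmx mulrAC -det_mulmx Q'Q det1 mul1r.
Qed.

Section HermitianForm.
Variables (C : numClosedFieldType) (n : nat) (H : 'M[C]_n).
Implicit Types x y z w : 'rV[C]_n.

Definition hform x y : C := (x *m H *m y ^t*) 0 0.

Lemma hformDl x y z : hform (x + y) z = hform x z + hform y z.
Proof. by rewrite /hform !mulmxDl mxE. Qed.

Lemma hformZl a x z : hform (a *: x) z = a * hform x z.
Proof. by rewrite /hform -!scalemxAl mxE. Qed.

Lemma hformDr x y z : hform x (y + z) = hform x y + hform x z.
Proof. by rewrite /hform linearD map_mxD mulmxDr mxE. Qed.

Lemma hformZr a x y : hform x (a *: y) = a^* * hform x y.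
Proof. by rewrite /hform linearZ map_mxZ -scalemxAr mxE. Qed.

Lemma hformNl x z : hform (- x) z = - hform x z.
Proof. by rewrite -scaleN1r hformZl mulN1r. Qed.

Lemma hformNr x z : hform z (- x) = - hform z x.
Proof. by rewrite -scaleN1r hformZr rmorphN1 mulN1r. Qed.

Lemma hform_delta i j : hform (delta_mx 0 i) (delta_mx 0 j) = H i j.
Proof.
by rewrite /hform trmx_delta map_delta_mx -rowE -colE !mxE.
Qed.

Lemma hform_deltar x j : hform x (delta_mx 0 j) = (x *m H) 0 j.
Proof. by rewrite /hform trmx_delta map_delta_mx -colE !mxE. Qed.

Definition hform_linE := (hformDl, hformDr, hformNl, hformNr, hformZl, hformZr).

Hypothesis herm_H : H ^t* = H.

Lemma hform_conj x y : (hform x y)^* = hform y x.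
Proof.
rewrite /hform -[RHS]trace_mx11 -mxtrace_tr trace_mx11.
have -> (M : 'M[C]_1) : (M 0 0)^* = (M ^ Num.conj) 0 0 by rewrite mxE.
by rewrite -[in RHS]herm_H !trmx_mul !map_mxM -!map_trmx !trmxK -map_mx_comp
  (map_mx_id (@conjCK _)) mulmxA.
Qed.

Hypothesis one_neg : num_neg_eigenvalues H = 1%N.

(** In an orthonormal eigenbasis B(x, x) is the sum of d_i |y_i|^2, so it is
    enough to kill the coordinate that belongs to the negative d_i. *)
Lemma neg_functional :
  exists phi : 'cV[C]_n, forall x, (x *m phi) 0 0 = 0 -> 0 <= hform x x.
Proof.
have Hs : H \is hermsymmx by apply/is_hermitianmxP; rewrite scale1r herm_H.
pose P := spectralmx H; pose d := spectral_diag H.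
have dR i : d 0 i \is Num.real.
  by have /mxOverP := hermitian_spectral_diag_real Hs; apply.
have HE : H = invmx P *m diag_mx d *m P.
  exact/orthomx_spectralP/hermitian_normalmx.
have count1 : count (fun i => d 0 i < 0) (enum 'I_n) = 1%N.
  have := eigenvaluesP H.
  rewrite [in char_poly _]HE char_poly_conj ?spectral_unit //.
  rewrite char_poly_trig ?diag_mx_is_trig //.
  rewrite (eq_bigr (fun i : 'I_n => 'X - (d 0 i)%:P)) => [|i _]; last first.
    by rewrite mxE eqxx mulr1n.
  rewrite -(big_map (fun i : 'I_n => d 0 i) xpredT (fun a => 'X - a%:P)).
  move=> /prod_XsubC_eq /permP /(_ (fun a => a < 0)).
  by rewrite -/(num_neg_eigenvalues H) one_neg count_map enumT => ->.
have [i0 di0 uniq_i0] : exists2 i0, d 0 i0 < 0 & forall i, d 0 i < 0 -> i = i0.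
  have /eqP := count1; rewrite -size_filter.
  case E: (filter _ _) => [|i0 [|//]] // _.
  have memE i : (i \in [:: i0]) = (d 0 i < 0).
    by rewrite -E mem_filter mem_enum andbT.
  exists i0; first by rewrite -memE mem_head.
  by move=> i; rewrite -memE inE => /eqP.
have iP : invmx P = P ^t* by rewrite invmx_unitary ?spectral_unitarymx.
exists (col i0 (invmx P)) => x; rewrite colE mulmxA -colE mxE => xi0.
pose y := x *m invmx P.
have -> : hform x x = (y *m diag_mx d *m y ^t*) 0 0.
  rewrite /hform HE iP /y iP trmx_mul map_mxM map_trmx trmxK -map_mx_comp.
  by rewrite (map_mx_id (@conjCK _)) !mulmxA.
rewrite mul_mx_diag mxE sumr_ge0 // => i _.
rewrite [X in X * _]mxE [X in _ * X]mxE [_^T _ _]mxE mulrAC -normCK.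
have [->|ne] := eqVneq i i0; first by rewrite /y xi0 normr0 expr0n mul0r.
rewrite mulr_ge0 ?exprn_ge0 // real_leNgt ?real0 //.
by apply: contraNN ne => /uniq_i0 ->.
Qed.

(** The plane spanned by [x] and [w] meets the kernel of the functional of
    [neg_functional]; at a vector a x - b w of this intersection the form is
    |a|^2 B(x, x) + |b|^2 B(w, w), where a <> 0 as [w] is not in the kernel. *)
Lemma hform_orth_neg_ge0 w x :
  hform w w < 0 -> hform x w = 0 -> 0 <= hform x x.
Proof.
move=> qw xw; have [phi phiP] := neg_functional.
have wx : hform w x = 0 by rewrite -hform_conj xw rmorph0.
pose a := (w *m phi) 0 0; pose b := (x *m phi) 0 0.
have a0 : a != 0.
  by apply/eqP => /phiP q; move: (lt_le_trans qw q); rewrite ltxx.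
have : 0 <= hform (a *: x - b *: w) (a *: x - b *: w).
  apply: phiP; rewrite mulmxBl -!scalemxAl.
  rewrite [LHS]mxE [X in X + _]mxE [X in _ + X]mxE [X in - X]mxE.
  by rewrite mulrC subrr.
have -> : hform (a *: x - b *: w) (a *: x - b *: w) =
    a * a^* * hform x x + b * b^* * hform w w.
  by rewrite !hform_linE xw wx; ring.
rewrite -!normCK => h.
have : 0 <= `|a| ^+ 2 * hform x x.
  apply: le_trans h _; rewrite gerDl; apply: mulr_ge0_le0 (ltW qw).
  exact: exprn_ge0.
by rewrite pmulr_rge0 // exprn_gt0 // normr_gt0.
Qed.

(** The degenerate case of the Cauchy-Schwarz inequality in the positive
    semidefinite orthogonal complement of [w]. *)
Lemma hform_orth_neg_radical w x :
  hform w w < 0 -> hform x w = 0 -> hform x x = 0 -> x *m H = 0.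
Proof.
move=> qw xw qx.
suff xz z : hform x z = 0.
  by apply/rowP => j; rewrite -hform_deltar xz mxE.
pose t := hform z w / hform w w.
have -> : hform x z = hform x (z - t *: w).
  by rewrite !hform_linE xw mulr0 subr0.
have zw : hform (z - t *: w) w = 0.
  by rewrite !hform_linE /t divfK ?subrr // lt_eqF.
move: (z - t *: w) zw => y yw; set c := hform x y.
apply/eqP/negPn/negP => c0.
have qy := hform_orth_neg_ge0 qw yw.
have nc : 0 < c * c^* by rewrite -normCK exprn_gt0 // normr_gt0.
(* The form at y - l c^* x is B(y, y) - 2 l |c|^2, and this [l] makes it -1. *)
pose l := (hform y y + 1) / (2 * (c * c^*)).
have lR : l^* = l.
  apply: conj_Creal; rewrite ger0_real // divr_ge0 ?addr_ge0 //.
  by rewrite mulr_ge0 // ltW.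
pose v := y - (l * c^*) *: x.
have /(hform_orth_neg_ge0 qw) : hform v w = 0.
  by rewrite !hform_linE xw yw mulr0 subr0.
have -> : hform v v = -1.
  rewrite !hform_linE qx -/c -(hform_conj x y) -/c rmorphM /= conjCK lR /l.
  move: (hform y y) => q; by field; rewrite fmorph_eq0 c0.
by rewrite lerNr oppr0 ler10.
Qed.

End HermitianForm.

(** * Consequences for digraphs *)

Definition link (D : digraph) (u v : vertex D) : bool * bool := (arc u v, arc v u).

Local Notation digon := (true, true).
Local Notation outarc := (true, false).
Local Notation inarc := (false, true).
Local Notation nonadj := (false, false).

Section Digraph.
Variables (C : numClosedFieldType) (D : digraph).
Implicit Types u v x y z : vertex D.
Local Notation V := (vertex D).
Local Notation H := (herm_adj C D).
Local Notation h := (@herm_entry C D).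
Definition evec u : 'rV[C]_#|V| := delta_mx 0 (enum_rank u).
Local Notation e := evec.
Local Notation B := (hform H).

Lemma herm_entry_conj u v : (h u v)^* = h v u.
Proof.
rewrite /herm_entry; case: (arc u v); case: (arc v u);
by rewrite ?rmorphN /= ?rmorph1 ?rmorph0 ?conjCi ?opprK.
Qed.

Lemma herm_entry_loop u : h u u = 0.
Proof. by rewrite /herm_entry !arc_irr. Qed.

Lemma herm_adj_herm : H ^t* = H.
Proof. by apply/matrixP => i j; rewrite !mxE herm_entry_conj. Qed.

Lemma hform_vertex u v : B (e u) (e v) = h u v.
Proof. by rewrite hform_delta mxE !enum_rankK. Qed.

Lemma hform_vertexr (x : 'rV_#|V|) u : (x *m H) 0 (enum_rank u) = B x (e u).
Proof. by rewrite hform_deltar. Qed.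

Hypothesis one_neg : num_neg_eigenvalues H = 1%N.

Lemma herm_entry_norm1 u v : h u v != 0 -> h u v * h v u = 1.
Proof.
rewrite /herm_entry; case: (arc u v); case: (arc v u); rewrite ?eqxx //= => _.
- by rewrite mulr1.
- by rewrite mulrN -expr2 sqrCi opprK.
- by rewrite mulNr -expr2 sqrCi opprK.
Qed.

(** This is the eigenvector for -1 of the edge, written with [h u v] so that it
    serves digons and arcs alike. *)
Lemma hform_edge_neg u v : h u v != 0 ->
  B (e u - h u v *: e v) (e u - h u v *: e v) < 0.
Proof.
move=> /herm_entry_norm1 uv.
have -> : B (e u - h u v *: e v) (e u - h u v *: e v) = - (h u v * h v u) *+ 2.
  by rewrite !hform_linE !hform_vertex !herm_entry_loop herm_entry_conj; ring.
by rewrite uv mulNrn oppr_lt0 ltr0n.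
Qed.

Lemma orth_edge_ge0 u v (x : 'rV_#|V|) :
  h u v != 0 -> B x (e u) = 0 -> B x (e v) = 0 -> 0 <= B x x.
Proof.
move=> uv xu xv.
apply: (hform_orth_neg_ge0 herm_adj_herm one_neg (hform_edge_neg uv)).
by rewrite !hform_linE xu xv mulr0 subr0.
Qed.

Lemma orth_edge_radical u v (x : 'rV_#|V|) :
    h u v != 0 -> B x (e u) = 0 -> B x (e v) = 0 -> B x x = 0 ->
  forall z, B x (e z) = 0.
Proof.
move=> uv xu xv xx z.
rewrite -hform_vertexr.
rewrite (hform_orth_neg_radical herm_adj_herm one_neg (hform_edge_neg uv)) ?mxE //.
by rewrite !hform_linE xu xv mulr0 subr0.
Qed.

(** The hypotheses say that e_y - c e_w is orthogonal to the edge and isotropic,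
    so it is in the radical. *)
Lemma proportional_rows u v w y (c : C) : h u v != 0 ->
    h y u = c * h w u -> h y v = c * h w v -> c * h w y + c^* * h y w = 0 ->
  forall x, h y x = c * h w x.
Proof.
move=> uv yu yv yw x; pose d := e y - c *: e w.
have dE z : B d (e z) = h y z - c * h w z by rewrite !hform_linE !hform_vertex.
apply/subr0_eq; rewrite -dE (orth_edge_radical uv) ?dE ?yu ?yv ?subrr //.
rewrite /d !hform_linE !hform_vertex !herm_entry_loop.
by transitivity (- (c * h w y + c^* * h y w)); [ring | rewrite yw oppr0].
Qed.

(** The form at e_y - e_z is -2 Re h_yz, while entries never have a negative
    real part; so e_y - e_z is isotropic and [y], [z] have the same row. *)
Lemma same_on_edge_eq u v y z : reduced C D -> h u v != 0 ->
  h y u = h z u -> h y v = h z v -> y = z.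
Proof.
move=> [no_twins _] uv yzu yzv; apply/eqP/negPn/negP => /eqP yz.
have : 0 <= - (h z y + h y z).
  have -> : - (h z y + h y z) = B (e y - e z) (e y - e z).
    by rewrite !hform_linE !hform_vertex !herm_entry_loop; ring.
  by rewrite (orth_edge_ge0 uv) // !hform_linE !hform_vertex ?yzu ?yzv subrr.
rewrite oppr_ge0 => le0.
have eq0 : h z y + h y z = 0.
  move: le0; rewrite /herm_entry; case: (arc y z); case: (arc z y);
    rewrite ?subrr ?addNr ?addr0 //.
  by move=> /(lt_le_trans (ltr0n C 2)); rewrite ltxx.
apply: (no_twins y z); split=> // x.
by rewrite (@proportional_rows u v z y 1) ?mul1r ?rmorph1 ?mul1r.
Qed.

Lemma hform_sum (s : seq (C * V)) z :
  B (\sum_(a <- s) a.1 *: e a.2) (e z) = \sum_(a <- s) a.1 * h a.2 z.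
Proof.
elim: s => [|a s IH]; last by rewrite !big_cons hformDl hformZl IH hform_vertex.
by rewrite !big_nil /hform !mul0mx mxE.
Qed.

Lemma hform_sum_orth w (s : seq (C * V)) :
  {in map snd s, forall p, B w (e p) = 0} -> B w (\sum_(a <- s) a.1 *: e a.2) = 0.
Proof.
elim: s => [|a s IH] ws.
  by rewrite big_nil /hform trmx0 map_mx0 mulmx0 mxE.
rewrite big_cons hformDr hformZr ws ?mem_head // mulr0 add0r IH // => p ps.
by rewrite ws // inE ps orbT.
Qed.

(** The list [s] describes a combination of basis vectors, with coefficients
    chosen so that subtracting it from e_y gives a vector orthogonal to all of
    them; the sum in the inequality is then minus the diagonal entry at [y] of
    the Schur complement. *)
Lemma schur_complement u v (s : seq (C * V)) y :
    h u v != 0 -> u \in map snd s -> v \in map snd s ->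
    {in map snd s, forall p, h y p = \sum_(a <- s) a.1 * h a.2 p} ->
  \sum_(a <- s) a.1 * h a.2 y <= 0 /\
  (\sum_(a <- s) a.1 * h a.2 y = 0 ->
   forall x, h y x = \sum_(a <- s) a.1 * h a.2 x).
Proof.
move=> uv us vs yE; pose w := e y - \sum_(a <- s) a.1 *: e a.2.
have wE x : B w (e x) = h y x - \sum_(a <- s) a.1 * h a.2 x.
  by rewrite hformDl hformNl hform_sum hform_vertex.
have w0 p : p \in map snd s -> B w (e p) = 0.
  by move=> ps; rewrite wE -yE ?subrr.
have qw : B w w = - \sum_(a <- s) a.1 * h a.2 y.
  suff -> : B w w = B w (e y) by rewrite wE herm_entry_loop sub0r.
  rewrite {2}/w hformDr hformNr.
  suff -> : B w (\sum_(a <- s) a.1 *: e a.2) = 0 by rewrite subr0.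
  exact: hform_sum_orth.
have [wu wv] := (w0 _ us, w0 _ vs); split.
  by rewrite -oppr_ge0 -qw (orth_edge_ge0 uv).
move=> q0 x; have := orth_edge_radical uv wu wv.
by rewrite qw q0 oppr0 => /(_ erefl x); rewrite wE => /subr0_eq.
Qed.

(** Entries are handled through their integer real and imaginary parts, so that
    inequalities between them are decided by computation. *)
Definition re_entry u v : int := arc u v && arc v u.
Definition im_entry u v : int := (arc u v : int) - (arc v u : int).

Lemma herm_entryE u v : h u v = (re_entry u v)%:~R + (im_entry u v)%:~R * 'i.
Proof.
rewrite /herm_entry /re_entry /im_entry.
case: (arc u v); case: (arc v u); rewrite /=; ring.
Qed.

(** * An induced triangle *)

Definition induces_Tm (p q r : V) :=
  [&& link p q == digon, link p r == outarc & link r q == outarc].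

(** A product of three entries 1, i, -i has negative real part only when one is
    1 and the other two are equal to i, or equal to -i: a digon whose ends are
    joined by a directed path of length two through the third vertex. *)
Lemma negative_triangle u v x :
  h x u * h u v * h v x + (h x u * h u v * h v x)^* < 0 ->
  exists p q r, induces_Tm p q r.
Proof.
have -> : h x u * h u v * h v x + (h x u * h u v * h v x)^* =
    (2 * (re_entry x u * re_entry u v * re_entry v x
     - re_entry x u * im_entry u v * im_entry v x
     - im_entry x u * re_entry u v * im_entry v x
     - im_entry x u * im_entry u v * re_entry v x))%:~R.
  have i2 := sqrCi C.
  rewrite !herm_entryE.
  move: (re_entry x u) (im_entry x u) (re_entry u v) (im_entry u v)
    (re_entry v x) (im_entry v x) => a b c d k l.
  by rewrite !(rmorphM, rmorphD) /= conjCi !rmorph_int; ring: i2.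
rewrite ltrz0 => neg.
suff : [|| induces_Tm u v x, induces_Tm v u x, induces_Tm v x u,
            induces_Tm x v u, induces_Tm x u v | induces_Tm u x v].
  by case/orP => [|/orP[|/orP[|/orP[|/orP[]]]]] ?; do 3!eexists; eassumption.
move: neg; rewrite /re_entry /im_entry /induces_Tm /link.
by case: (arc x u); case: (arc u x); case: (arc u v); case: (arc v u);
  case: (arc v x); case: (arc x v).
Qed.

Lemma rank_edge_span u v (a b : V -> C) :
  (forall x z, h x z = a x * h u z + b x * h v z) -> (\rank H <= 2)%N.
Proof.
move=> span; set ru := row (enum_rank u) H; set rv := row (enum_rank v) H.
have /mxrankS/leq_trans -> // : (H <= ru + rv)%MS.
  apply/row_subP => i.
  have -> : row i H = a (enum_val i) *: ru + b (enum_val i) *: rv.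
    by apply/rowP => j; rewrite !mxE !enum_rankK span.
  by rewrite addmx_sub_adds // scalemx_sub.
apply: (leq_trans (mxrank_adds_leqif _ _)).
exact: (@leq_add _ _ 1 1 (rank_leq_row _) (rank_leq_row _)).
Qed.

Lemma exists_induced_Tm : (2 < \rank H)%N -> exists p q r, induces_Tm p q r.
Proof.
move=> rkH.
have /matrix0Pn[i [j]] : H != 0 by apply: contraTneq rkH => ->; rewrite mxrank0.
rewrite mxE; set u := enum_val i; set v := enum_val j => uv.
have uv1 := herm_entry_norm1 uv.
have uvE : h v u * h u v = 1 by rewrite mulrC.
pose t x := h x u * h u v * h v x.
have schur x : t x + (t x)^* <= 0 /\
    (t x + (t x)^* = 0 ->
     forall z, h x z = h x v * h v u * h u z + h x u * h u v * h v z).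
  have := @schur_complement u v [:: (h x v * h v u, u); (h x u * h u v, v)] x uv.
  rewrite /= !inE !eqxx orbT => /(_ erefl erefl).
  case=> [p|le0 eq0].
  - rewrite !inE !big_cons big_nil /= => /orP[] /eqP->; rewrite !herm_entry_loop.
      by rewrite -[_ * h u v * h v u]mulrA uv1; ring.
    by rewrite -[_ * h v u * h u v]mulrA uvE; ring.
  - have tE : t x + (t x)^* = h x v * h v u * h u x + h x u * h u v * h v x.
      by rewrite /t !rmorphM /= !herm_entry_conj; ring.
    rewrite tE; move: le0 eq0; rewrite !big_cons big_nil /= addr0 => le0 eq0.
    by split=> // q0 z; rewrite (eq0 q0) !big_cons big_nil /= addr0.
have [/existsP[x tx]|] := boolP [exists x, t x + (t x)^* != 0].
  have [le0 _] := schur x.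
  by apply: (@negative_triangle u v x); rewrite lt_neqAle tx.
rewrite negb_exists => /forallP t0; suff : (\rank H <= 2)%N by rewrite leqNgt rkH.
apply: (@rank_edge_span u v (fun x => h x v * h v u) (fun x => h x u * h u v)) => x.
by have [_] := schur x; apply; apply/eqP; rewrite -[_ == _]negbK.
Qed.

(** * Vertices outside of the triangle *)

Section Extension.
Hypothesis red : reduced C D.
Variables p q r : V.
Hypothesis pqr : induces_Tm p q r.

Definition attachment y := (link y p, link y q, link y r).

Let Tm_entries : h p q = 1 /\ h q p = 1 /\ h p r = 'i /\
   h r p = - 'i /\ h r q = 'i /\ h q r = - 'i.
Proof.
by case/and3P: pqr => /eqP[pq qp] /eqP[pr rp] /eqP[rq qr];
  rewrite /herm_entry pq qp pr rp rq qr; do ?split.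
Qed.

(** The inequality 2 |r_y|^2 <= |r_y v|^2 for v = (1, -1, i), in real and
    imaginary parts. *)
Lemma attachment_norm y :
  2 * (re_entry y p ^+ 2 + im_entry y p ^+ 2 +
       (re_entry y q ^+ 2 + im_entry y q ^+ 2) +
       (re_entry y r ^+ 2 + im_entry y r ^+ 2)) <=
  (re_entry y p - re_entry y q - im_entry y r) ^+ 2 +
  (im_entry y p - im_entry y q + re_entry y r) ^+ 2.
Proof.
have i2 := sqrCi C.
have half_gt0 : 0 < 2^-1 :> C by rewrite invr_gt0 ltr0n.
have [pq [qp [pr [rp [rq qr]]]]] := Tm_entries.
have pq0 : h p q != 0 by rewrite pq oner_eq0.
(* The row of entries of [y] at p, q, r times the inverse I - v v^* / 2. *)
pose c1 := (h y p + h y q - 'i * h y r) / 2.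
pose c2 := (h y p + h y q + 'i * h y r) / 2.
pose c3 := (h y r + 'i * h y p - 'i * h y q) / 2.
have := @schur_complement p q [:: (c1, p); (c2, q); (c3, r)] y pq0.
rewrite /= !inE !eqxx orbT !big_cons big_nil /= => /(_ erefl erefl) [x|le0 _].
  by rewrite !inE !big_cons big_nil /= /c1 /c2 /c3 => /or3P[] /eqP->;
    rewrite !herm_entry_loop ?pq ?qp ?pr ?rp ?rq ?qr; field: i2.
rewrite -subr_le0 -(ler_int C) -(pmulr_rle0 _ (half_gt0)).
move: le0; rewrite -[h p y]herm_entry_conj -[h q y]herm_entry_conj
   -[h r y]herm_entry_conj.
rewrite {}/c1 {}/c2 {}/c3 !herm_entryE.
move: (re_entry y p) (im_entry y p) (re_entry y q) (im_entry y q)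
  (re_entry y r) (im_entry y r) => a b c d k l.
rewrite !(rmorphD, rmorphM) /= conjCi !rmorph_int addr0.
by congr (is_true (_ <= 0)); field: i2.
Qed.

(** In this order they give T^-_a, T^-_b, T^-_b again, and K^-. *)
Definition new_attachments := [:: (outarc, inarc, nonadj); (outarc, nonadj, digon);
  (nonadj, inarc, digon); (outarc, inarc, digon)].

(** Among the eight triples that satisfy [attachment_norm], the rows of p, q, r
    belong to these vertices alone, and 0 belongs to isolated vertices. *)
Lemma new_vertex_attachment y :
  y \notin [:: p; q; r] -> attachment y \in new_attachments.
Proof.
rewrite !inE !negb_or => /and3P[yp yq yr].
have [pq [qp [pr [rp [rq qr]]]]] := Tm_entries.
have pq0 : h p q != 0 by rewrite pq oner_eq0.
have sep z : h y p = h z p -> h y q = h z q -> y = z := same_on_edge_eq red pq0.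
have notp : attachment y != (nonadj, digon, outarc).
  apply: contraNneq yp => - [yp1 yp2 yq1 yq2 _ _]; apply/eqP/sep.
    by rewrite herm_entry_loop /herm_entry yp1 yp2.
  by rewrite pq /herm_entry yq1 yq2.
have notq : attachment y != (digon, nonadj, inarc).
  apply: contraNneq yq => - [yp1 yp2 yq1 yq2 _ _]; apply/eqP/sep.
    by rewrite qp /herm_entry yp1 yp2.
  by rewrite herm_entry_loop /herm_entry yq1 yq2.
have notr : attachment y != (inarc, outarc, nonadj).
  apply: contraNneq yr => - [yp1 yp2 yq1 yq2 _ _]; apply/eqP/sep.
    by rewrite rp /herm_entry yp1 yp2.
  by rewrite rq /herm_entry yq1 yq2.
have not0 : attachment y != (nonadj, nonadj, nonadj).
  apply/eqP => - [yp1 yp2 yq1 yq2 _ _]; case: red => _ /(_ y); apply=> z.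
  have : h y z = 0.
    rewrite (@proportional_rows p q p y 0) ?mul0r // ?rmorph0 ?mul0r ?addr0 //.
      by rewrite /herm_entry yp1 yp2.
    by rewrite /herm_entry yq1 yq2.
  rewrite /herm_entry; case: (arc y z); case: (arc z y) => //= /eqP.
  - by rewrite oner_eq0.
  - by rewrite (negPf (neq0Ci C)).
  - by rewrite oppr_eq0 (negPf (neq0Ci C)).
move: notp notq notr not0 (attachment_norm y).
rewrite /re_entry /im_entry /attachment /link /new_attachments.
by case: (arc y p); case: (arc p y); case: (arc y q); case: (arc q y);
  case: (arc y r); case: (arc r y).
Qed.

Lemma herm_entry_neqN1 u v : h u v <> -1.
Proof.
have N11 : -1 <> 1 :> C by move/esym/eqP; rewrite -subr_eq0 opprK (eqr_nat C 2 0).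
rewrite /herm_entry; case: (arc u v); case: (arc v u).
- by move/esym.
- by move/(congr1 (fun a => a ^+ 2)); rewrite sqrCi sqrrN expr1n.
- by move/(congr1 (fun a => a ^+ 2)); rewrite !sqrrN sqrCi expr1n.
- by move/esym/eqP; rewrite oppr_eq0 oner_eq0.
Qed.

(** A vertex attached as in T^-_a has row -1 times the row of [r], and one
    attached as in T^-_b has row i times the row of [q] or -i times that of
    [p].  Comparing with the entries of a differently attached vertex gives the
    impossible entry -1. *)
Lemma new_vertex_unique y z :
  attachment y \in new_attachments -> attachment z \in new_attachments -> y = z.
Proof.
have [pq [qp [pr [rp [rq qr]]]]] := Tm_entries.
have pq0 : h p q != 0 by rewrite pq oner_eq0.
have i2 : 'i * 'i = -1 :> C by rewrite -expr2 sqrCi.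
have clash a b w c : h a p = c * h w p -> h a q = c * h w q -> h a w = 0 ->
    c * h w b <> -1.
  move=> ap aq aw; rewrite -(proportional_rows pq0 ap aq) //.
    exact: herm_entry_neqN1.
  by rewrite -[h w a]herm_entry_conj aw rmorph0 !mulr0 addr0.
have clash_a a b : attachment a = (outarc, inarc, nonadj) -> link b r != digon.
  case=> a1 a2 a3 a4 a5 a6; apply/eqP => - [b1 b2].
  by apply: (@clash a b r (-1)); rewrite ?rp ?rq /herm_entry
    ?(a1, a2, a3, a4, a5, a6, b1, b2) ?mulN1r ?opprK //.
have clash_b a b : attachment a = (outarc, nonadj, digon) -> link b q != inarc.
  case=> a1 a2 a3 a4 a5 a6; apply/eqP => - [b1 b2].
  by apply: (@clash a b q 'i); rewrite ?qp ?herm_entry_loop /herm_entry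
    ?(a1, a2, a3, a4, a5, a6, b1, b2) ?mulr1 ?mulr0 ?i2 //.
have clash_b' a b : attachment a = (nonadj, inarc, digon) -> link b p != outarc.
  case=> a1 a2 a3 a4 a5 a6; apply/eqP => - [b1 b2].
  by apply: (@clash a b p (- 'i)); rewrite ?pq ?herm_entry_loop /herm_entry
    ?(a1, a2, a3, a4, a5, a6, b1, b2) ?mulr1 ?mulr0 ?mulrNN ?i2 //.
have same a b : attachment a = attachment b -> a = b.
  move=> [a1 a2 a3 a4 _ _]; apply: (same_on_edge_eq red pq0);
    by rewrite /herm_entry ?(a1, a2, a3, a4).
have links a t : attachment a = t ->
    [/\ link a p = t.1.1, link a q = t.1.2 & link a r = t.2].
  by move=> <-.
rewrite !inE => /or4P[] /eqP ty /or4P[] /eqP tz; have [yp yq yr] := links _ _ ty;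
  have [zp zq zr] := links _ _ tz; first
  [ by apply: same; rewrite ty tz
  | by have := clash_a y z ty; rewrite zr
  | by have := clash_a z y tz; rewrite yr
  | by have := clash_b y z ty; rewrite zq
  | by have := clash_b z y tz; rewrite yq
  | by have := clash_b' y z ty; rewrite zp
  | by have := clash_b' z y tz; rewrite yp ].
Qed.

End Extension.
End Digraph.

(** * Identification of the digraph *)

Lemma isomorphic_listing (D : digraph) n (a : rel 'I_n) (a_irr : irreflexive a)
    (s : n.-tuple (vertex D)) :
  uniq s -> (forall v, v \in s) ->
  (forall i j, arc (tnth s i) (tnth s j) = a i j) ->
  isomorphic D (Digraph a_irr).
Proof.
move=> s_uniq s_all s_arc.
have index_lt v : (index v s < n)%N.
  by rewrite -[X in (_ < X)%N](size_tuple s) index_mem.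
pose f v : vertex (Digraph a_irr) := Ordinal (index_lt v).
have fK : cancel f (tnth s) by move=> v; rewrite (tnth_nth v) nth_index.
exists f; last by move=> u v; rewrite -[LHS]s_arc !fK.
exists (tnth s) => // i; apply/val_inj.
by rewrite /= (tnth_nth (tnth s i)) index_uniq ?size_tuple.
Qed.

Lemma isomorphic_of_attachments (D : digraph) (p q r : vertex D) :
  induces_Tm p q r ->
  (forall y, y \notin [:: p; q; r] -> attachment p q r y \in new_attachments) ->
  (forall y z, attachment p q r y \in new_attachments ->
    attachment p q r z \in new_attachments -> y = z) ->
  isomorphic D Tm \/ isomorphic D Tma \/ isomorphic D Tmb \/ isomorphic D Km.
Proof.
case/and3P => /eqP[pq qp] /eqP[pr rp] /eqP[rq qr] newP new1.
have pqN : p != q by apply/eqP => E; rewrite E arc_irr in pq.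
have prN : p != r by apply/eqP => E; rewrite E arc_irr in pr.
have qrN : q != r by apply/eqP => E; rewrite E arc_irr in rq.
have pqr_uniq : uniq [:: p; q; r] by rewrite /= !inE negb_or pqN prN qrN.
have [/forallP all3|] := boolP [forall y, y \in [:: p; q; r]].
  left; apply: (@isomorphic_listing D _ _ _ [tuple p; q; r]) => //.
  by move=> [[|[|[|//]]] ?] [[|[|[|//]]] ?]; rewrite !(tnth_nth p) /= ?arc_irr.
rewrite negb_forall => /existsP[y y_new].
have yT := newP y y_new.
have all4 v : v \in [:: y; p; q; r].
  rewrite in_cons; have [//|/newP vT] := boolP (v \in [:: p; q; r]).
    by rewrite orbT.
  by rewrite (new1 v y vT yT) eqxx.
have listing a (a_irr : irreflexive a) (s : 4.-tuple (vertex D)) :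
    {subset [:: y; p; q; r] <= s} ->
    (forall i j, arc (tnth s i) (tnth s j) = a i j) ->
    isomorphic D (Digraph a_irr).
  move=> sub; apply: isomorphic_listing => [|v]; last exact/sub/all4.
  by rewrite (leq_size_uniq _ sub) ?size_tuple // cons_uniq y_new pqr_uniq.
right; move: yT; rewrite !inE => /or4P[] /eqP[yp py yq qy yr ry];
  [left | right; left | right; left | right; right].
- apply: (listing _ _ [tuple p; q; r; y]).
    by move=> v; rewrite !inE; do 4!case: (v == _).
  by move=> [[|[|[|[|//]]]] ?] [[|[|[|[|//]]]] ?]; rewrite !(tnth_nth p) /= ?arc_irr.
- apply: (listing _ _ [tuple p; q; r; y]).
    by move=> v; rewrite !inE; do 4!case: (v == _).
  by move=> [[|[|[|[|//]]]] ?] [[|[|[|[|//]]]] ?]; rewrite !(tnth_nth p) /= ?arc_irr.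
- (* The arc between the two vertices of degree three is r -> q here, and not
     p -> r as in the previous case; it must be listed as 1 -> 3. *)
  apply: (listing _ _ [tuple r; y; q; p]).
    by move=> v; rewrite !inE; do 4!case: (v == _).
  by move=> [[|[|[|[|//]]]] ?] [[|[|[|[|//]]]] ?]; rewrite !(tnth_nth p) /= ?arc_irr.
- apply: (listing _ _ [tuple p; q; r; y]).
    by move=> v; rewrite !inE; do 4!case: (v == _).
  by move=> [[|[|[|[|//]]]] ?] [[|[|[|[|//]]]] ?]; rewrite !(tnth_nth p) /= ?arc_irr.
Qed.

Theorem theorem4p2 (C : numClosedFieldType) (D : digraph)
    (hred : reduced C D)
    (hrank : (2 < \rank (herm_adj C D))%N)
    (hneg : num_neg_eigenvalues (herm_adj C D) = 1%N) :
  isomorphic D Tm \/ isomorphic D Tma \/ isomorphic D Tmb \/ isomorphic D Km.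
Proof.
have [p [q [r pqr]]] := exists_induced_Tm hneg hrank.
apply: (isomorphic_of_attachments pqr) => [y|y z].
  exact: (new_vertex_attachment hneg).
exact: (new_vertex_unique hneg).
Qed.
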